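(* For any odd prime $p$ and any irreducible polynomial $P(t)\in\mathbb{F}_p[t]$, the Laurent series $\Phi(t):=\Theta_p(P(t))\in\mathbb{F}_p(\!(t^{-1})\!)$ exhibits full maximal escape of mass with respect to the sequence $\{P(t)^k\}_{k\ge0}$.
   Context: The $p$-Cantor sequence: for an odd prime $p$, $p_2=\frac{p-1}{2}$, identify $\{0,\dots,p-1\}$ with $\mathbb{F}_p$ and let $\phi_p(n)$ be the word of length $p$ whose $i$-th letter ($0\le i\le p-1$) is $n\binom{p_2}{i/2}\bmod p$ for even $i$ and $0$ for odd $i$; $\phi_p$ acts on words by concatenation. $(c^{(p)}_i)_{i\ge0}=\lim_n\phi_p^n(1)$ and $\Theta_p(t)=t^{-1}\sum_{i\ge0}c^{(p)}_it^{-i}$. For $\Theta(t)=\sum_{i=-h}^\infty a_it^{-i}$, $\Theta(P(t)):=\sum_{i=-h}^\infty a_iP(t)^{-i}$. Maximal escape of mass: for a quadratic irrational $\Theta\in\mathbb{F}_q(\!(t^{-1})\!)$ and irreducible $P$, let $\ell_{\Theta P^k}$ be the period length of the eventually periodic continued fraction of $\Theta P^k$ and $A_1^{[\Theta P^k]},\dots,A^{[\Theta P^k]}_{\ell_{\Theta P^k}}$ the partial quotients of one period; $R_{k,n}=\frac{\sum_i\max\{\deg A_i^{[\Theta P^k]}-n,0\}}{\sum_i\deg A_i^{[\Theta P^k]}}$. $\Theta$ exhibits $c$-maximal escape of mass w.r.t. $\{P^k\}$ if $\lim_{n\to\infty}\limsup_{k\to\infty}R_{k,n}\ge c$, and full maximal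 escape of mass if this holds with $c=1$. *)

(* Defs.v *)
From mathcomp Require Import all_boot all_algebra.
From mathcomp Require Import all_classical all_reals all_analysis Rstruct.
Set Implicit Arguments. Unset Strict Implicit. Unset Printing Implicit Defensive.
Import GRing.Theory Num.Theory.
Local Open Scope ring_scope.

(* Laurent series in t^{-1} over a field F, i.e. F((t^{-1})).          *)
(* A series is given by its coefficient function: x e = coefficient    *)
(* of t^e (e : int).  It is a Laurent series in t^{-1} when only       *)
(* finitely many positive powers of t occur.                           *)
Section Laurent.
Variable F : fieldType.

Definition laurent := int -> F.

Definition is_laurent (x : laurent) : Prop :=
  exists N : int, forall i : int, N < i -> x i = 0.

Definition lbound (x : laurent) : int :=
  match pselect (is_laurent x) with
  | left H => projT1 (cid H)
  | right _ => 0
  end.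

Definition lzero : laurent := fun _ => 0.
Definition lone : laurent := fun e => if e == 0 then 1 else 0.
Definition ladd (x y : laurent) : laurent := fun e => x e + y e.
Definition lopp (x : laurent) : laurent := fun e => - x e.
Definition lsub (x y : laurent) : laurent := fun e => x e - y e.

(* Cauchy product: coefficient of t^m is sum_{i+j=m} x_i y_j, where    *)
(* only i <= Nx, j <= Ny contribute (finite sum).                      *)
Definition lmul (x y : laurent) : laurent := fun m =>
  let Nx := lbound x in let Ny := lbound y in
  if m <= Nx + Ny then
    \sum_(k < (absz (Nx + Ny - m)%R).+1) x (Nx - k%:Z) * y (m - Nx + k%:Z)
  else 0.

Definition lexp (x : laurent) (n : nat) : laurent := iter n (lmul x) lone.

Definition linv (x : laurent) : laurent :=
  match pselect (exists y, is_laurent y /\ lmul x y = lone) with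
  | left H => projT1 (cid H)
  | right _ => lzero
  end.

Definition lpoly (P : {poly F}) : laurent :=
  fun e => match e with Posz n => P`_n | Negz _ => 0 end.

Definition polypart (x : laurent) : {poly F} :=
  \poly_(i < (absz (lbound x)).+1) x (Posz i).
Definition fracpart (x : laurent) : laurent :=
  fun e => if e < 0 then x e else 0.

Definition lrational (x : laurent) : Prop :=
  exists u v : {poly F}, v != 0 /\ lmul (lpoly v) x = lpoly u.

Definition quad_irrational (x : laurent) : Prop :=
  is_laurent x /\ ~ lrational x /\
  exists a b c : {poly F}, (a != 0 \/ b != 0 \/ c != 0) /\
    ladd (ladd (lmul (lpoly a) (lmul x x)) (lmul (lpoly b) x)) (lpoly c) = lzero.

(* Substitution Theta(P(t)) = sum_e theta_e P(t)^e  (theta_e the       *)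
(* coefficient of t^e of Theta).  For deg P >= 1 the term P^e with     *)
(* e < min(m,0) has degree e*deg P < m, hence does not contribute to   *)
(* the coefficient of t^m; terms with e > lbound Theta vanish.  So the *)
(* (t^{-1}-adically convergent) sum has the finite coefficient formula *)
Definition lpowz (x : laurent) (e : int) : laurent :=
  match e with
  | Posz n => lexp x n
  | Negz n => lexp (linv x) n.+1
  end.

Definition lsubst (T : laurent) (P : {poly F}) : laurent := fun m =>
  let N := lbound T in
  let lo := Num.min m 0 in
  if lo <= N then
    \sum_(k < (absz (N - lo)%R).+1) T (lo + k%:Z) * lpowz (lpoly P) (lo + k%:Z) m
  else 0.

Fixpoint cf_quot (x : laurent) (n : nat) : laurent :=
  match n with
  | 0 => x
  | n'.+1 => linv (fracpart (cf_quot x n'))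
  end.

Definition cf_pq (x : laurent) (n : nat) : {poly F} := polypart (cf_quot x n).

Definition cf_period (x : laurent) (l : nat) : Prop :=
  (0 < l)%N /\ exists n0 : nat, cf_quot x (n0 + l) = cf_quot x n0.

Definition cf_min_period (x : laurent) (l : nat) : Prop :=
  cf_period x l /\ forall l', cf_period x l' -> (l <= l')%N.

Definition period_length (x : laurent) : nat :=
  match pselect (exists l, cf_min_period x l) with
  | left H => projT1 (cid H)
  | right _ => 0%N
  end.

Definition period_start (x : laurent) : nat :=
  match pselect (exists n0, cf_quot x (n0 + period_length x) = cf_quot x n0) with
  | left H => projT1 (cid H)
  | right _ => 0%N
  end.

Definition period_deg (x : laurent) (i : nat) : nat :=
  (size (cf_pq x (period_start x + i))).-1.

End Laurent.

Local Open Scope ereal_scope.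

Definition escape_ratio (F : fieldType) (T : laurent F) (P : {poly F}) (k n : nat)
  : \bar Rdefinitions.R :=
  let x := lmul T (lpoly (P ^+ k)) in
  let l := period_length x in
  ((\sum_(i < l) (period_deg x i - n)%N)%:R
     / (\sum_(i < l) period_deg x i)%:R)%R%:E.

Definition c_max_escape (F : fieldType) (c : Rdefinitions.R) (T : laurent F)
  (P : {poly F}) : Prop :=
  quad_irrational T /\
  c%:E <= limn (fun n => limn_esup (fun k => escape_ratio T P k n)).

Definition full_max_escape (F : fieldType) (T : laurent F) (P : {poly F}) : Prop :=
  c_max_escape 1%R T P.

Local Close Scope ereal_scope.

Definition phi_letter (p : nat) (n : 'F_p) (i : nat) : 'F_p :=
  if odd i then 0 else n * ('C(p.-1./2, i./2))%:R.

Definition phi_p (p : nat) (w : seq 'F_p) : seq 'F_p :=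
  flatten [seq [seq phi_letter n i | i <- iota 0 p] | n <- w].

(* c_i = i-th letter of lim_n phi_p^n(1); phi_p^n(1) is a prefix of    *)
(* phi_p^{n+1}(1) of length p^n, so c_i is the i-th letter of          *)
(* phi_p^{i+1}(1).                                                     *)
Definition cantor_seq (p : nat) (i : nat) : 'F_p :=
  nth 0 (iter i.+1 (@phi_p p) [:: 1]) i.

(* Theta_p(t) = t^{-1} sum_{i>=0} c_i t^{-i}: coefficient of t^e is    *)
(* c_{-e-1} for e <= -1 and 0 otherwise                                *)
Definition Theta_p (p : nat) : laurent 'F_p := fun e =>
  match e with
  | Posz _ => 0
  | Negz n => cantor_seq p n
  end.

(* Main.v *)
Require Import Defs.
From mathcomp Require Import all_boot all_order all_algebra all_field.
From mathcomp Require Import all_classical all_reals all_analysis Rstruct.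
From mathcomp Require Import zify ring.
From HB Require Import structures.
Set Implicit Arguments. Unset Strict Implicit. Unset Printing Implicit Defensive.
Import Order.TTheory GRing.Theory Num.Theory.
Local Open Scope ring_scope.

(** The first [q = p^M] letters of the [p]-Cantor sequence are the coefficients of [(1 + x^2)^((q-1)/2)]. Hence, with [W = P^2 + 1] and [S = W^((q-1)/2)], the series [Phi = Theta_p(P)] satisfies [P^q Phi = S + delta] with [delta] of negative degree; letting [M] grow, [W Phi^2 = 1]. So [Phi] is quadratic, and it is irrational because [W] is not a square. Moreover
   [delta * (P^q Phi + S) * W = P^(2q) W Phi^2 - W S^2 = P^(2q) - W^q = -1],
   so that [1 / delta = -2 W S - W delta] and [1 / (- W delta) = 2 S + delta]: the continued fraction of [P^q Phi] is [S; -2WS, 2S, -2WS, 2S, ...]. All its partial quotients have degree at least [(q - 1) deg P], so the escape ratio for [k = q] is at least [1 - n / ((q - 1) deg P)], whatever the period. *)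

(** * The ring of Laurent series *)

Section LaurentRing.
Variable F : fieldType.
Implicit Types (x y z : laurent F) (p : {poly F}).

(** [lbound] is an arbitrarily chosen upper bound, not the degree, so every estimate carries an
    explicit bound instead. *)
Definition deg_le (N : int) x := forall i : int, N < i -> x i = 0.

Lemma deg_leW N M x : N <= M -> deg_le N x -> deg_le M x.
Proof. by move=> NM xN i Mi; apply: xN; apply: le_lt_trans Mi. Qed.

Lemma lboundP x : is_laurent x -> deg_le (Defs.lbound x) x.
Proof. by move=> xL; rewrite /Defs.lbound; case: pselect => // H; case: cid. Qed.

Definition lconv x y (m A : int) (n : nat) : F :=
  \sum_(k < n) x (A - k%:Z) * y (m - A + k%:Z).

Lemma lconv_shift x y (m A : int) n j : deg_le A x ->
  lconv x y m (A + j%:Z) (j + n) = lconv x y m A n.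
Proof.
move=> xA; elim: j => [|j <-]; first by rewrite addr0.
rewrite /lconv addSn big_ord_recl /= xA ?mul0r ?add0r; last by lia.
by apply: eq_bigr => k _; congr (x _ * y _); rewrite /= /bump; lia.
Qed.

Lemma lconv_widen x y (m A M : int) n n' : deg_le M y -> M + A - m < n%:Z ->
  (n <= n')%N -> lconv x y m A n' = lconv x y m A n.
Proof.
move=> yM Hn /subnK <-; elim: (n' - n)%N => [//|j IH].
rewrite /lconv addSn big_ord_recr /= -/(lconv _ _ _ _ _) IH yM ?mulr0 ?addr0 //.
by lia.
Qed.

(** The bounds chosen inside [lmul] do not matter: starting higher only adds terms where [x]
    vanishes, and stopping later only adds terms where [y] vanishes. *)
Lemma lmul_lconv x y A B (m : int) n : deg_le A x -> deg_le B y ->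
  B + A - m < n%:Z -> lmul x y m = lconv x y m A n.
Proof.
move=> xA yB Hn.
have xL : is_laurent x by exists A.
have yL : is_laurent y by exists B.
have [xN yM] := (lboundP xL, lboundP yL).
rewrite /lmul; set N := Defs.lbound x in xN *; set M := Defs.lbound y in yM *.
have -> : (if m <= N + M then
  \sum_(k < (absz (N + M - m)%R).+1) x (N - k%:Z) * y (m - N + k%:Z) else 0) =
  lconv x y m N (if m <= N + M then (absz (N + M - m)%R).+1 else 0%N).
  by case: ifP => // _; rewrite /lconv big_ord0.
set n0 := (X in lconv x y m N X).
have Hn0 : M + N - m < n0%:Z by rewrite /n0; case: ifP; lia.
(* [C] lies above both [A] and [N], so both sums can be restarted at the same exponent and then
   compared by length. *)
clearbody n0; pose C := (absz A + absz N)%N.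
have cv D E k : deg_le D x -> deg_le E y -> D <= C -> E + D - m < k%:Z ->
    lconv x y m D k = lconv x y m (Posz C) (absz (Posz C - D)%R + k)%N.
  move=> xD yE DC Hk.
  by rewrite -(lconv_shift y m k (absz (Posz C - D)%R) xD); congr lconv; lia.
rewrite (cv N M n0) // 1?(cv A B n) //; try lia.
have [/(lconv_widen x yM)|/ltnW/(lconv_widen x yB)] := leqP (absz (Posz C - N)%R + n0)%N (absz (Posz C - A)%R + n)%N.
  by move=> ->//; lia.
by move=> ->//; lia.
Qed.

Lemma deg_le_mul A B x y : deg_le A x -> deg_le B y -> deg_le (A + B) (lmul x y).
Proof.
move=> xA yB m Hm; rewrite (lmul_lconv (n := 0%N) xA yB) ?/lconv ?big_ord0 //.
by lia.
Qed.

Lemma is_laurent_mul x y : is_laurent x -> is_laurent y -> is_laurent (lmul x y).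
Proof. by move=> [A xA] [B yB]; exists (A + B); apply: deg_le_mul. Qed.

(* The coefficient of [t^(A-k)] in [x] becomes that of ['X^k]. *)
Definition trunc (A : int) (K : nat) x : {poly F} := \poly_(k < K) x (A - k%:Z).

(** Through this reduction the product of series inherits commutativity, associativity and the unit
    law from polynomials. *)
Lemma lmul_trunc x y A B K k : deg_le A x -> deg_le B y -> (k < K)%N ->
  lmul x y (A + B - k%:Z) = (trunc A K x * trunc B K y)`_k.
Proof.
move=> xA yB kK; rewrite (lmul_lconv (n := k.+1) xA yB); last by lia.
rewrite coefM; apply: eq_bigr => -[j /= jk] _; rewrite !coef_poly.
rewrite !ifT; try lia.
by congr (_ * y _); lia.
Qed.

Lemma lmul_lead x y A B : deg_le A x -> deg_le B y ->
  lmul x y (A + B) = x A * y B.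
Proof.
move=> xA yB; rewrite (lmul_lconv (n := 1%N) xA yB); last by lia.
by rewrite /lconv big_ord1 /= subr0 addr0 addrC addKr.
Qed.

Lemma laurent_eq A x y : deg_le A x -> deg_le A y ->
  (forall k : nat, x (A - k%:Z) = y (A - k%:Z)) -> x = y.
Proof.
move=> xA yA E; apply/funext => m.
have [Am|mA] := ltP A m; first by rewrite xA ?yA.
by rewrite (_ : m = A - (absz (A - m)%R)%:Z) ?E //; lia.
Qed.

Lemma eq_coefM (p p' r r' : {poly F}) k :
  (forall j, (j <= k)%N -> p`_j = p'`_j) ->
  (forall j, (j <= k)%N -> r`_j = r'`_j) -> (p * r)`_k = (p' * r')`_k.
Proof.
by move=> E E'; rewrite !coefM; apply: eq_bigr => -[j /= jk] _; rewrite E ?E' //; lia.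
Qed.

Lemma lmulC x y : is_laurent x -> is_laurent y -> lmul x y = lmul y x.
Proof.
move=> [A xA] [B yB]; have yx := deg_le_mul yB xA; rewrite addrC in yx.
apply: (laurent_eq (deg_le_mul xA yB) yx) => k.
rewrite (lmul_trunc xA yB (ltnSn k)) (addrC A B) (lmul_trunc yB xA (ltnSn k)).
by rewrite mulrC.
Qed.

Lemma lmulA x y z : is_laurent x -> is_laurent y -> is_laurent z ->
  lmul x (lmul y z) = lmul (lmul x y) z.
Proof.
move=> [A xA] [B yB] [C zC].
have [xy yz] := (deg_le_mul xA yB, deg_le_mul yB zC).
have H := deg_le_mul xA yz; rewrite addrA in H.
apply: (laurent_eq H (deg_le_mul xy zC)) => k.
rewrite -{1}addrA (lmul_trunc xA yz (ltnSn k)) (lmul_trunc xy zC (ltnSn k)).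
(* Coefficient [k] of a product uses only coefficients up to [k] of its factors, so a truncated
   product may be replaced by the product of truncations. *)
transitivity (trunc A k.+1 x * (trunc B k.+1 y * trunc C k.+1 z))`_k.
  apply: eq_coefM => // j jk; rewrite coef_poly ifT; last by lia.
  by rewrite (lmul_trunc (K := k.+1) yB zC).
rewrite mulrA; apply: eq_coefM => // j jk; rewrite coef_poly ifT; last by lia.
by rewrite (lmul_trunc (K := k.+1) xA yB).
Qed.

Lemma deg_le_one : deg_le 0 (lone F).
Proof. by move=> i i0; rewrite /lone gt_eqF. Qed.

Lemma lmul1x x : is_laurent x -> lmul (lone F) x = x.
Proof.
move=> [A xA]; have H := deg_le_mul deg_le_one xA; rewrite add0r in H.
apply: (laurent_eq H xA) => k.
rewrite -{1}[A]add0r (lmul_trunc deg_le_one xA (ltnSn k)).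
rewrite (_ : trunc 0 k.+1 (lone F) = 1) ?mul1r ?coef_poly ?ltnSn //.
apply/polyP => j; rewrite coef_poly coefC /lone.
have -> : (0 - j%:Z == 0) = (j == 0%N) by lia.
by case: j => [|j]; rewrite ?ltnS //=; case: ifP.
Qed.

Lemma deg_le_add A x y : deg_le A x -> deg_le A y -> deg_le A (ladd x y).
Proof. by move=> xA yA i Ai; rewrite /ladd xA ?yA ?addr0. Qed.

Lemma deg_le_opp A x : deg_le A x -> deg_le A (lopp x).
Proof. by move=> xA i Ai; rewrite /lopp xA ?oppr0. Qed.

Lemma is_laurent_add x y : is_laurent x -> is_laurent y -> is_laurent (ladd x y).
Proof.
move=> [A xA] [B yB]; exists (Num.max A B).
by apply: deg_le_add; [apply: deg_leW xA|apply: deg_leW yB]; rewrite le_max lexx ?orbT.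
Qed.

Lemma is_laurent_opp x : is_laurent x -> is_laurent (lopp x).
Proof. by move=> [A /deg_le_opp]; exists A. Qed.

Lemma lmulDl x y z : is_laurent x -> is_laurent y -> is_laurent z ->
  lmul (ladd x y) z = ladd (lmul x z) (lmul y z).
Proof.
move=> [A xA] [B yB] [C zC]; pose D := Num.max A B.
have xD : deg_le D x by apply: deg_leW xA; rewrite le_max lexx.
have yD : deg_le D y by apply: deg_leW yB; rewrite le_max lexx orbT.
have xyD := deg_le_add xD yD.
apply/funext => m; rewrite /ladd.
rewrite (lmul_lconv (n := (absz (C + D - m)%R).+1) xyD zC); last by lia.
rewrite (lmul_lconv (n := (absz (C + D - m)%R).+1) xD zC); last by lia.
rewrite (lmul_lconv (n := (absz (C + D - m)%R).+1) yD zC); last by lia.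
by rewrite /lconv -big_split; apply: eq_bigr => k _; rewrite mulrDl.
Qed.

Lemma deg_le_lpoly p : deg_le (size p).-1 (lpoly p).
Proof. by move=> [i|i] //= Hi; rewrite nth_default //; lia. Qed.

Lemma lpolyM (p r : {poly F}) : lpoly (p * r) = lmul (lpoly p) (lpoly r).
Proof.
have [pA rB] := (@deg_le_lpoly p, @deg_le_lpoly r).
apply/funext => -[m|m]; last first.
  rewrite (lmul_lconv (n := (absz (Posz (size r).-1 + (size p).-1 - Negz m)%R).+1) pA rB); last by lia.
  rewrite /lconv big1 // => k _.
  have H (a b : int) : a + b = Negz m -> lpoly p a * lpoly r b = 0.
    by case: a => a; case: b => b; rewrite /= ?mul0r ?mulr0 //; lia.
  by apply: H; ring.
(* Starting at [m + s] splits the sum into three blocks: [s] terms with negative exponents of [r],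
   then the [m + 1] terms of the polynomial product, then terms with negative exponents of [p]. *)
pose s := (size p).-1; pose C := Posz (m + s).
have pC : deg_le C (lpoly p) by apply: deg_leW pA; rewrite /C /s; lia.
rewrite (lmul_lconv (n := s + (m.+1 + (size r).-1)) pC rB); last by rewrite /C; lia.
rewrite /lconv big_split_ord /= big1 ?add0r => [|k _]; last first.
  have -> : Posz m - C + k = Negz (s - k.+1) by have := ltn_ord k; rewrite /C; lia.
  by rewrite mulr0.
rewrite big_split_ord /= [X in _ + X]big1 ?addr0 => [|k _]; last first.
  have -> : C - (s + (m.+1 + k))%N%:Z = Negz k by rewrite /C; lia.
  by rewrite mul0r.
rewrite coefMr; apply: eq_bigr => -[k /= km] _.
by rewrite (_ : C - (s + k)%N%:Z = (m - k)%N%:Z) 1?(_ : Posz m - C + (s + k)%N%:Z = k) // /C; lia.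
Qed.

Lemma lpoly1 : lpoly 1 = lone F.
Proof. by apply/funext => -[[|m]|m]; rewrite /lone //= coefC. Qed.

(** [laurent F] contains all functions on [int], while the laws of [lmul] are proved for Laurent
    series only; the subtype carries the ring structure. *)
Definition lser := {x : laurent F | `[< is_laurent x >]}.
HB.instance Definition _ := Choice.on lser.

Definition Lser x (H : is_laurent x) : lser := exist _ x (asboolT H).
Lemma lserP (x : lser) : is_laurent (val x). Proof. exact: asboolW (valP x). Qed.

Lemma lser0_subproof : is_laurent (lzero F).
Proof. by exists 0. Qed.
Lemma lser1_subproof : is_laurent (lone F).
Proof. by exists 0; apply: deg_le_one. Qed.
Definition lser0 := Lser lser0_subproof.
Definition lser1 := Lser lser1_subproof.
Definition lser_add (x y : lser) := Lser (is_laurent_add (lserP x) (lserP y)).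
Definition lser_opp (x : lser) := Lser (is_laurent_opp (lserP x)).
Definition lser_mul (x y : lser) := Lser (is_laurent_mul (lserP x) (lserP y)).

Lemma lser_addA : associative lser_add.
Proof. by move=> x y z; apply/val_inj/funext => i; apply: addrA. Qed.
Lemma lser_addC : commutative lser_add.
Proof. by move=> x y; apply/val_inj/funext => i; apply: addrC. Qed.
Lemma lser_add0 : left_id lser0 lser_add.
Proof. by move=> x; apply/val_inj/funext => i; apply: add0r. Qed.
Lemma lser_addN : left_inverse lser0 lser_opp lser_add.
Proof. by move=> x; apply/val_inj/funext => i; apply: addNr. Qed.
HB.instance Definition _ :=
  GRing.isZmodule.Build lser lser_addA lser_addC lser_add0 lser_addN.

Lemma lser_mulA : associative lser_mul.
Proof. by move=> x y z; apply/val_inj/lmulA; apply: lserP. Qed.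
Lemma lser_mulC : commutative lser_mul.
Proof. by move=> x y; apply/val_inj/lmulC; apply: lserP. Qed.
Lemma lser_mul1 : left_id lser1 lser_mul.
Proof. by move=> x; apply/val_inj/lmul1x; apply: lserP. Qed.
Lemma lser_mulDl : left_distributive lser_mul lser_add.
Proof. by move=> x y z; apply/val_inj/lmulDl; apply: lserP. Qed.
Lemma lser_oner_neq0 : lser1 != 0.
Proof.
apply/eqP => /(congr1 (fun x : lser => val x 0)) /eqP.
by rewrite /= /lone /lzero eqxx oner_eq0.
Qed.
HB.instance Definition _ := GRing.Zmodule_isComNzRing.Build lser
  lser_mulA lser_mulC lser_mul1 lser_mulDl lser_oner_neq0.

Lemma is_laurent_lpoly p : is_laurent (lpoly p).
Proof. by exists (size p).-1; apply: deg_le_lpoly. Qed.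
Definition lp p : lser := Lser (is_laurent_lpoly p).

Lemma lp_is_zmod_morphism : zmod_morphism lp.
Proof.
move=> p r; apply/val_inj/funext => -[m|m] /=; rewrite /ladd /lopp /=.
  by rewrite coefB.
by rewrite oppr0 addr0.
Qed.
HB.instance Definition _ := GRing.isZmodMorphism.Build _ _ lp lp_is_zmod_morphism.

Lemma lp_is_monoid_morphism : monoid_morphism lp.
Proof. by split=> [|p r]; apply/val_inj; [apply: lpoly1|apply: lpolyM]. Qed.
HB.instance Definition _ := GRing.isMonoidMorphism.Build _ _ lp lp_is_monoid_morphism.

End LaurentRing.

(** * Degree bounds, inverses, polynomial and fractional parts of Laurent series *)

Section LaurentTheory.
Variable F : fieldType.
Implicit Types (x y z f : lser F) (p : {poly F}).

Lemma degD N x y : deg_le N (val x) -> deg_le N (val y) -> deg_le N (val (x + y)).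
Proof. exact: deg_le_add. Qed.

Lemma degN N x : deg_le N (val x) -> deg_le N (val (- x)).
Proof. exact: deg_le_opp. Qed.

Lemma degM N M x y : deg_le N (val x) -> deg_le M (val y) ->
  deg_le (N + M) (val (x * y)).
Proof. exact: deg_le_mul. Qed.

Lemma deg_lp (n : nat) p : (size p <= n.+1)%N -> deg_le n (val (lp p)).
Proof. by move=> pn; apply: deg_leW (@deg_le_lpoly _ p); lia. Qed.

Lemma degX (N : int) n x : deg_le N (val x) -> deg_le (N * n%:Z) (val (x ^+ n)).
Proof.
move=> xN; elim: n => [|n IH]; first by rewrite mulr0 expr0; apply: deg_le_one.
by rewrite exprS (_ : N * n.+1%:Z = N + N * n%:Z); [apply: degM|lia].
Qed.

Lemma lser_eq0 x : (forall N : nat, deg_le (- N%:Z) (val x)) -> x = 0.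
Proof.
by move=> xN; apply/val_inj/funext => i; apply: (xN (absz i).+1); lia.
Qed.

(** As long as the bound on [y] exceeds [- A], the top coefficient of [x * y] sits at a positive
    exponent and must vanish; since [val x A] is nonzero, the bound drops by one. *)
Lemma deg_le_inv (A : int) x y : deg_le A (val x) -> val x A != 0 -> x * y = 1 ->
  deg_le (- A) (val y).
Proof.
move=> xA xA0 xy1; have [B yB] := lserP y.
have yB' : deg_le (- A + (absz (B + A)%R)%:Z) (val y) by apply: deg_leW yB; lia.
elim: (absz _) yB' => [|n IH]; first by rewrite addr0.
move=> yB'; apply: IH => i Hi.
have [|iB] := ltP (- A + n.+1%:Z) i; first exact: yB'.
have -> : i = - A + n.+1%:Z by lia.
have := lmul_lead xA yB'; rewrite addNKr.
have -> : lmul (val x) (val y) = lone F by apply: (congr1 val xy1).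
by move/esym/eqP; rewrite /lone mulf_eq0 (negPf xA0) => /eqP.
Qed.

Lemma lp_inj : injective (@lp F).
Proof.
move=> p r E; apply/polyP => i.
exact: (congr1 (fun x : lser F => val x (Posz i)) E).
Qed.

Lemma lexpE x n : lexp (val x) n = val (x ^+ n).
Proof. by elim: n => // n IH; rewrite exprS; apply: (congr1 (lmul _) IH). Qed.

(** [linv] takes some inverse by choice, and inverses in a commutative ring are unique. *)
Lemma linvE x y : x * y = 1 -> linv (val x) = val y.
Proof.
move=> xy1; rewrite /linv; case: pselect => [H|[]]; last first.
  by exists (val y); split; [apply: lserP|apply: (congr1 val xy1)].
case: cid => /= z [zL xz1]; pose w : lser F := Lser zL.
have xw1 : x * w = 1 by apply: val_inj.
have -> : z = val w by [].
by rewrite -[w]mulr1 -xy1 mulrA (mulrC w) xw1 mul1r.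
Qed.

(* With [Q] the reversed polynomial and [c] its constant coefficient, [Q / c = 1 - f] with [X] dividing [f], so the [k]-th coefficient of its inverse is already that of the partial geometric sum up to [f^k]. *)
Lemma lp_inv p : p != 0 -> exists y, lp p * y = 1.
Proof.
move=> p0; pose A := (size p).-1; pose c := lead_coef p.
have c0 : c != 0 by rewrite lead_coef_eq0.
pose Q := \poly_(k < A.+1) p`_(A - k).
pose f := 1 - c^-1 *: Q.
have Xf i k : (k < i)%N -> (f ^+ i)`_k = 0.
  elim: i k => // i IH k ki; rewrite exprS coefM big1 // => -[[|j] /= jk] _.
    by rewrite coefB coefZ coef_poly /= coef1 /= subn0 mulVf ?subrr ?mul0r.
  by rewrite IH ?mulr0 //; lia.
pose g k := \sum_(i < k.+1) f ^+ i.
have gE j k : (j <= k)%N -> (g k)`_j = (g j)`_j.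
  move=> /subnK <-; elim: (k - j)%N => // i IH.
  by rewrite addSn /g big_ord_recr coefD /= -/(g _) IH Xf ?addr0 // ltnS leq_addl.
have gQ k : Q * (c^-1 *: g k) = 1 - f ^+ k.+1.
  rewrite -opprB subrX1 -mulNr opprB -scalerAr scalerAl; congr (_ * _).
  by rewrite /f opprB addrC subrK.
pose y e := if e <= - A%:Z then c^-1 * (g (absz (e + A%:Z)%R))`_(absz (e + A%:Z)%R) else 0.
have yA : deg_le (- A%:Z) y by move=> i Hi; rewrite /y ifF //; lia.
have pA : deg_le A (lpoly p) by apply: deg_le_lpoly.
have yL : is_laurent y by exists (- A%:Z).
exists (Lser yL); apply: val_inj => /=.
have H := deg_le_mul pA yA; rewrite subrr in H.
apply: (laurent_eq H (@deg_le_one F)) => k.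
rewrite -{1}(subrr A%:Z) (lmul_trunc pA yA (ltnSn k)).
transitivity (Q * (c^-1 *: g k))`_k.
  apply: eq_coefM => j jk; rewrite coef_poly ltnS jk.
    rewrite /Q coef_poly ltnS; have [jA|Aj] := leqP j A; first by rewrite subzn.
    by have -> : A%:Z - j%:Z = Negz (j - A).-1 by lia.
  have -> : - A%:Z - j%:Z = - (A + j)%N%:Z by lia.
  rewrite /y ifT; last by lia.
  have -> : absz (- (A + j)%N%:Z + A%:Z)%R = j by lia.
  by rewrite coefZ (gE j k).
rewrite gQ coefB coef1 Xf // subr0 /lone sub0r oppr_eq0.
by case: k.
Qed.

(** The cut-off in [polypart] depends on the chosen [lbound], but lies above it and so loses no
    nonzero coefficient. *)
Lemma polypartE p f : deg_le (- 1) (val f) -> polypart (val (lp p + f)) = p.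
Proof.
move=> fN; set x := lp p + f.
have xE (i : nat) : val x i = p`_i by rewrite /= /ladd fN ?addr0.
apply/polyP => i; rewrite coef_poly; case: ltnP => [_|Hi]; first exact: xE.
by rewrite -xE (lboundP (lserP x)) //; lia.
Qed.

Lemma fracpartE p f : deg_le (- 1) (val f) -> fracpart (val (lp p + f)) = val f.
Proof.
move=> fN; apply/funext => i; rewrite /fracpart; case: ifP => Hi.
  by rewrite /= /ladd; case: i Hi => // i _; rewrite add0r.
by rewrite fN //; lia.
Qed.

End LaurentTheory.

(** * The p-Cantor words *)

Section CantorWords.
Variables (p : nat) (P : {poly 'F_p}).
Hypotheses (p_pr : prime p) (p_odd : odd p).
Implicit Types (w v : seq 'F_p).

(* [P ^ size w * \sum_i w_i P^(- i - 1)], the corresponding section of [Theta_p(P)] with denominators cleared. *)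
Definition word_eval w : {poly 'F_p} := foldl (fun r a => r * P + a%:P) 0 w.

Lemma word_eval_rcons w a : word_eval (rcons w a) = word_eval w * P + a%:P.
Proof. by rewrite /word_eval foldl_rcons. Qed.

Lemma word_eval_cat w v :
  word_eval (w ++ v) = word_eval w * P ^+ size v + word_eval v.
Proof.
elim/last_ind: v => [|v a IH].
  by rewrite cats0 expr0 mulr1 addr0.
by rewrite -rcons_cat !word_eval_rcons IH size_rcons exprSr; ring.
Qed.

Lemma word_evalE w :
  word_eval w = \sum_(i < size w) w`_i *: P ^+ (size w - i.+1).
Proof.
elim/last_ind: w => [|w a IH]; first by rewrite big_ord0.
rewrite word_eval_rcons size_rcons big_ord_recr /= subnn expr0 nth_rcons ltnn eqxx.
rewrite alg_polyC; congr (_ + _); rewrite IH mulr_suml; apply: eq_bigr => i _.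
by rewrite nth_rcons ltn_ord -scalerAl -exprSr subSS -subSn.
Qed.

Lemma sum_even (V : nmodType) h (G : nat -> V) : (forall i, odd i -> G i = 0) ->
  \sum_(i < h.*2.+1) G i = \sum_(i < h.+1) G i.*2.
Proof.
move=> G0; elim: h => [|h IH]; first by rewrite !big_ord1.
rewrite doubleS big_ord_recr big_ord_recr /= IH [RHS]big_ord_recr /= doubleS.
by rewrite (G0 h.*2.+1) ?addr0 //= odd_double.
Qed.

Lemma odd_prime_halfE : p = p.-1./2.*2.+1.
Proof. by have := prime_gt0 p_pr; lia. Qed.

(** The letters at even positions are [n] times the binomial coefficients of [(P^2 + 1)^h] with
    [h = (p-1)/2]; those at odd positions vanish. *)
Lemma word_eval_letters (n : 'F_p) :
  word_eval [seq phi_letter n i | i <- iota 0 p] =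
  n%:P * (P ^+ 2 + 1) ^+ p.-1./2.
Proof.
rewrite word_evalE size_map size_iota; set h := p.-1./2.
transitivity (\sum_(i < h.*2.+1) phi_letter n i *: P ^+ (h.*2 - i)).
  rewrite /h -odd_prime_halfE; apply: eq_bigr => i _.
  rewrite (nth_map 0%N) ?size_iota // nth_iota // add0n; congr (_ *: _ ^+ _).
  by rewrite {1}odd_prime_halfE subSS.
rewrite (@sum_even _ h (fun i => phi_letter n i *: P ^+ (h.*2 - i))); last first.
  by move=> i oi; rewrite /phi_letter oi scale0r.
rewrite exprDn mulr_sumr; apply: eq_bigr => i _.
rewrite /phi_letter odd_double doubleK -/h -doubleB expr1n mulr1 -exprM mul2n.
by rewrite -mul_polyC polyCM -mulrA polyC_natr mulr_natl.
Qed.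

Lemma pchar_polyFp : p \in [pchar {poly 'F_p}].
Proof. by rewrite pchar_poly pchar_Fp. Qed.

Lemma Fp_expp (a : 'F_p) : a ^+ p = a.
Proof. by have := expf_card a; rewrite card_Fp. Qed.

(** Each letter [a] becomes a block of value [a (P^2 + 1)^((p-1)/2)], and shifting by a block
    multiplies by [P^p]. Since [a^p = a], Frobenius turns the sum of these shifts into a [p]-th
    power. *)
Lemma word_eval_phi w :
  word_eval (phi_p w) = word_eval w ^+ p * (P ^+ 2 + 1) ^+ p.-1./2.
Proof.
elim/last_ind: w => [|w a IH].
  by rewrite expr0n (gtn_eqF (prime_gt0 p_pr)) mul0r.
rewrite /phi_p map_rcons flatten_rcons word_eval_cat -/(phi_p w) IH.
rewrite word_eval_letters size_map size_iota word_eval_rcons.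
rewrite [X in _ = X * _]exprDn_pchar ?pnatE ?pchar_polyFp //.
by rewrite -polyC_exp Fp_expp exprMn; ring.
Qed.

Lemma size_phi w : size (phi_p w) = (size w * p)%N.
Proof.
rewrite /phi_p size_flatten /shape -map_comp.
by elim: w => //= a w ->; rewrite size_map size_iota mulSn.
Qed.

Lemma size_iter_phi M : size (iter M (@phi_p p) [:: 1]) = (p ^ M)%N.
Proof. by elim: M => //= M IH; rewrite size_phi IH expnSr. Qed.

(** This matches the exponents in the recursion [S_(M+1) = S_M^p (P^2 + 1)^((p-1)/2)]. *)
Lemma half_predM q r : odd q -> odd r ->
  (q * r).-1./2 = (q.-1./2 * r + r.-1./2)%N.
Proof.
move=> oq or; have -> : (q * r = (q.-1./2 * r).*2 + r)%N.
  have {1}-> : q = q.-1./2.*2.+1 by lia.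
  by rewrite mulSn doubleMl addnC.
by move: (_ * r)%N => m; lia.
Qed.

Lemma word_eval_iter M : word_eval (iter M (@phi_p p) [:: 1]) =
  (P ^+ 2 + 1) ^+ (p ^ M).-1./2.
Proof.
elim: M => [|M IH]; first by rewrite /word_eval /= mul0r add0r.
rewrite iterS word_eval_phi IH -exprM -exprD; congr (_ ^+ _).
by rewrite expnSr half_predM // // oddX p_odd orbT.
Qed.

Lemma phi_prefix w v : prefix w v -> prefix (phi_p w) (phi_p v).
Proof.
by move=> /prefixP[u ->]; rewrite /phi_p map_cat flatten_cat prefix_prefix.
Qed.

Lemma iter_phi_prefix M N : (M <= N)%N ->
  prefix (iter M (@phi_p p) [:: 1]) (iter N (@phi_p p) [:: 1]).
Proof.
have H K : prefix (iter K (@phi_p p) [:: 1]) (iter K.+1 (@phi_p p) [:: 1]).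
  elim: K => [|K IH]; last exact: phi_prefix.
  (* Base case: the image of the letter [1] starts with [1], because ['C(h, 0) = 1]. *)
  rewrite /= /phi_p /= cats0 [X in iota 0 X]odd_prime_halfE /=.
  by rewrite {1}/phi_letter /= bin0 mulr1 eqxx prefix0s.
move=> /subnK <-; elim: (N - M)%N => [|k IH]; first by rewrite add0n prefix_refl.
by apply: prefix_trans IH _; apply: H.
Qed.

(** The iterates are prefixes of one another, so any two that are long enough share their [i]-th
    letter. *)
Lemma cantor_seqE M i : (i < p ^ M)%N ->
  cantor_seq p i = (iter M (@phi_p p) [:: 1])`_i.
Proof.
move=> iM; rewrite /cantor_seq.
have ii : (i < p ^ i.+1)%N.
  by apply: leq_trans (ltn_expl i.+1 (prime_gt1 p_pr)); lia.
have nthp w v : prefix w v -> (i < size w)%N -> v`_i = w`_i.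
  by move=> /prefixP[u ->] iw; rewrite nth_cat iw.
have [/iter_phi_prefix/nthp|/ltnW/iter_phi_prefix/nthp] := leqP M i.+1.
  by rewrite size_iter_phi => /(_ iM).
by rewrite size_iter_phi => /(_ ii).
Qed.

Lemma cantor_sum M :
  \sum_(i < p ^ M) cantor_seq p i *: P ^+ (p ^ M - i.+1) =
  (P ^+ 2 + 1) ^+ (p ^ M).-1./2.
Proof.
rewrite -word_eval_iter word_evalE size_iter_phi.
by apply: eq_bigr => i _; rewrite -cantor_seqE.
Qed.

End CantorWords.

(** * Substitution *)

Section Substitution.
Variables (F : fieldType) (T : laurent F) (P : {poly F}) (u : lser F).
Hypotheses (T_deg : deg_le (- 1) T) (P_size : (1 < size P)%N) (Pu : lp P * u = 1).
Let d := (size P).-1.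

Lemma eq_sum_support (V : nmodType) (f : nat -> V) n n' :
  (forall k, (n <= k)%N -> f k = 0) -> (forall k, (n' <= k)%N -> f k = 0) ->
  \sum_(k < n) f k = \sum_(k < n') f k.
Proof.
have H a b : (forall k, (a <= k)%N -> f k = 0) -> (a <= b)%N ->
    \sum_(k < b) f k = \sum_(k < a) f k.
  move=> f0 /subnK <-; elim: (b - a)%N => [//|j IH].
  by rewrite addSn big_ord_recr /= IH f0 ?addr0 // leq_addl.
move=> fn fn'; have [/(H _ _ fn) ->//|/ltnW/(H _ _ fn') //] := leqP n n'.
Qed.

Lemma deg_le_lp_inv : deg_le (- d%:Z) (val u).
Proof.
apply: deg_le_inv Pu; first by apply: deg_lp; rewrite /d; lia.
by rewrite /= lead_coef_eq0 -size_poly_gt0; lia.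
Qed.

(** The power [u^(i+1)] has degree at most [- (i+1) d], so the terms with [i >= Q] cannot reach the
    exponent [m]. *)
Lemma lsubstE Q (m : int) : - (Q.+1 * d)%N%:Z < m ->
  lsubst T P m = \sum_(i < Q) T (Negz i) * val (u ^+ i.+1) m.
Proof.
move=> Qm; rewrite /lsubst.
set N := Defs.lbound T; set lo := Num.min m 0; pose a := absz lo.
have loE : lo = - a%:Z by rewrite /a /lo; lia.
have am : - a%:Z <= m by rewrite -loE /lo; lia.
have d0 : (0 < d)%N by rewrite /d; lia.
pose f k := T (lo + k%:Z) * lpowz (lpoly P) (lo + k%:Z) m.
have -> : (if lo <= N then \sum_(k < (absz (N - lo)%R).+1) f k else 0) =
    \sum_(k < if lo <= N then (absz (N - lo)%R).+1 else 0%N) f k.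
  by case: ifP => // _; rewrite big_ord0.
(* [T] vanishes from exponent [0] on, so [a] terms suffice whatever [lbound] is. *)
rewrite (@eq_sum_support _ f _ a); last 2 first.
- move=> k Hk; rewrite /f lboundP ?mul0r //; first by exists (- 1).
  by move: Hk; rewrite -/N; case: ifP; lia.
- by move=> k ka; rewrite /f T_deg ?mul0r //; lia.
pose g i := T (Negz i) * val (u ^+ i.+1) m.
transitivity (\sum_(i < a) g i).
  (* Reversing the order makes index [i] stand for the exponent [- (i+1)], which is [Negz i]. *)
  rewrite (reindex_inj rev_ord_inj); apply: eq_bigr => i _ /=.
  have -> : f (a - i.+1)%N = T (Negz i) * lpowz (lpoly P) (Negz i) m.
    by rewrite /f; have -> : lo + (a - i.+1)%N%:Z = Negz i by have := ltn_ord i; lia.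
  by rewrite /= (linvE Pu : linv (lpoly P) = val u) lexpE /g exprS.
apply: eq_sum_support => k Hk; rewrite /g (degX (n := k.+1) deg_le_lp_inv) ?mulr0 //.
  by apply: lt_le_trans am; nia.
by apply: le_lt_trans Qm; nia.
Qed.

Lemma deg_le_lsubst : deg_le (- d%:Z) (lsubst T P).
Proof. by move=> m Hm; rewrite (@lsubstE 0) ?big_ord0 //; lia. Qed.

Lemma is_laurent_lsubst : is_laurent (lsubst T P).
Proof. by exists (- d%:Z); apply: deg_le_lsubst. Qed.

Definition lser_subst : lser F := Lser is_laurent_lsubst.

Lemma lser_sumE (I : finType) (c : I -> F) (x : I -> lser F) m :
  val (\sum_i lp (c i)%:P * x i) m = \sum_i c i * val (x i) m.
Proof.
rewrite (big_morph (fun y : lser F => val y m) (id1 := 0) (op1 := +%R)) //.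
apply: eq_bigr => i _; have [A xA] := lserP (x i).
have cA : deg_le 0 (val (lp (c i)%:P)) by apply: deg_lp; rewrite size_polyC; lia.
have [mA|Am] := leP m A; last first.
  by rewrite xA // mulr0 (degM cA xA) // add0r.
rewrite -[LHS]/(lmul (val (lp (c i)%:P)) (val (x i)) m).
rewrite (lmul_lconv (n := (absz (A - m)%R).+1) cA xA); last by lia.
rewrite /lconv big_ord_recl /= !subr0 big1 ?addr0 ?coefC //= => k _.
exact: mul0r.
Qed.

Lemma lser_subst_trunc Q :
  deg_le (- (Q.+1 * d)%N%:Z)
    (val (lser_subst - \sum_(i < Q) lp (T (Negz i))%:P * u ^+ i.+1)).
Proof.
move=> m Qm; rewrite [LHS]/= /ladd /lopp lser_sumE /= (lsubstE Qm).
exact: subrr.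
Qed.

End Substitution.

(** * The continued fraction of P^q Phi *)

Section ContinuedFraction.
Variables (p : nat) (P : {poly 'F_p}) (u : lser 'F_p).
Hypotheses (p_pr : prime p) (p_odd : odd p) (P_size : (1 < size P)%N).
Hypothesis Pu : lp P * u = 1.
Let d := (size P).-1.
Let W : {poly 'F_p} := P ^+ 2 + 1.

Lemma deg_le_Theta : deg_le (- 1) (Theta_p p).
Proof. by case. Qed.

Let Phi := lser_subst deg_le_Theta P_size Pu.
Let S M : {poly 'F_p} := W ^+ (p ^ M).-1./2.
Let delta M := lp P ^+ (p ^ M) * Phi - lp (S M).

Lemma d_gt0 : (0 < d)%N. Proof. by rewrite /d; lia. Qed.

Lemma size_W : size W = (d * 2).+1.
Proof.
have s : size (P ^+ 2) = (d * 2).+1.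
  have P0 : P != 0 by rewrite -size_poly_gt0; lia.
  by rewrite -[LHS]prednK ?size_exp // size_poly_gt0 expf_neq0.
by rewrite /W size_polyDl s // size_polyC oner_eq0; have := d_gt0; lia.
Qed.

Lemma W_neq0 : W != 0. Proof. by rewrite -size_poly_gt0 size_W. Qed.

Lemma size_S M : size (S M) = (d * (p ^ M).-1).+1.
Proof.
have oM : odd (p ^ M) by rewrite oddX p_odd orbT.
rewrite -[LHS]prednK; last by rewrite size_poly_gt0 expf_neq0 ?W_neq0.
rewrite size_exp size_W /=; congr _.+1.
by rewrite -mulnA; congr (_ * _)%N; lia.
Qed.

(** With [q = p^M] odd, the left side is [W^q], which Frobenius expands. *)
Lemma S_sqr M : lp W * lp (S M) ^+ 2 = lp P ^+ (p ^ M) ^+ 2 + 1.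
Proof.
have oM : odd (p ^ M) by rewrite oddX p_odd orbT.
rewrite -!rmorphXn -rmorphM -(rmorph1 (@lp 'F_p)) -rmorphD; congr lp.
rewrite /S -[X in _ * X]exprM -exprS.
have -> : ((p ^ M).-1./2 * 2).+1 = (p ^ M)%N by lia.
rewrite exprDn_pchar ?pnatX ?pnatE ?pchar_polyFp // expr1n.
by rewrite -!exprM mulnC.
Qed.

Lemma deg_le_u : deg_le (- d%:Z) (val u).
Proof. exact: deg_le_lp_inv Pu. Qed.

Lemma deg_le_P n : deg_le (d * n)%N (val (lp P ^+ n)).
Proof.
have H : deg_le d (val (lp P)) by apply: deg_lp; apply: leqSpred.
by have := degX (n := n) H; rewrite -PoszM.
Qed.

(** The first [q] terms of [P^q Phi] add up to [S M] by [cantor_sum], and the tail has degree at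
    most [q d - (q+1) d]. This crude bound is sharpened in [delta_deg]. *)
Lemma delta_deg0 M : deg_le (- d%:Z) (val (delta M)).
Proof.
set q := (p ^ M)%N.
have E : lp P ^+ q * (\sum_(i < q) lp (Theta_p p (Negz i))%:P * u ^+ i.+1) = lp (S M).
  rewrite /S -cantor_sum // rmorph_sum mulr_sumr; apply: eq_bigr => -[i /= iq] _.
  rewrite -mul_polyC rmorphM rmorphXn mulrCA; congr (_ * _).
  by rewrite -{1}(subnK iq) exprD -mulrA -exprMn Pu expr1n mulr1.
rewrite /delta -E -mulrBr.
apply: (deg_leW _ (degM (deg_le_P (n := q)) (lser_subst_trunc (Q := q) _ _ _))).
by rewrite -/d; lia.
Qed.

Lemma deg_le_lpS M : deg_le (d * (p ^ M).-1)%N (val (lp (S M))).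
Proof. by apply: deg_lp; rewrite size_S. Qed.

Lemma deg_le_lpW : deg_le (d * 2)%N (val (lp W)).
Proof. by apply: deg_lp; rewrite size_W. Qed.

Lemma Phi_sqr : lp W * Phi ^+ 2 = 1.
Proof.
apply/eqP; rewrite -subr_eq0; apply/eqP/lser_eq0 => N.
pose q := (p ^ N)%N; set A := lp P ^+ q; set D := delta N; set s := lp (S N).
have [SW AU] : lp W * s ^+ 2 = A ^+ 2 + 1 /\ A * u ^+ q = 1.
  by rewrite S_sqr -exprMn Pu expr1n.
(* Here [2s + D], [D] and [W] have degrees at most [d (q-1)], [- d] and [2 d], so the last factor
   has degree at most [d q]. With [u^(2q)] the total is at most [- d q <= - N]. *)
have -> : lp W * Phi ^+ 2 - 1 = u ^+ q * u ^+ q * (1 + (s + s + D) * D * lp W).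
  have -> : (s + s + D) * D * lp W = A ^+ 2 * (lp W * Phi ^+ 2) - lp W * s ^+ 2.
    by rewrite /D /delta -/A -/s; ring.
  rewrite SW; transitivity ((A * u ^+ q) ^+ 2 * (lp W * Phi ^+ 2 - 1)); last by ring.
  by rewrite AU expr1n mul1r.
have Nq : (N < q)%N by apply: ltn_expl; apply: prime_gt1.
have dD := delta_deg0 N; have ds := deg_le_lpS (M := N); have dW := deg_le_lpW.
have dU := degX (n := q) deg_le_u.
have H2 : deg_le (d * q.-1)%N (val (s + s + D)).
  by apply: degD; [apply: degD|apply: deg_leW dD; nia].
have H1 : deg_le (d * q)%N (val (1 + (s + s + D) * D * lp W)).
  apply: degD; first by apply: deg_leW (@deg_le_one _).
  apply: deg_leW (degM (degM H2 dD) dW); have : (0 < q)%N by lia.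
  by case: (q) => // r _; nia.
apply: deg_leW (degM (degM dU dU) H1).
by have := d_gt0; nia.
Qed.

Lemma two_neq0 : (2%:R : 'F_p) != 0.
Proof.
rewrite -(dvdn_pcharf (pchar_Fp p_pr)); apply/negP => /dvdn_leq /=.
by have := prime_gt1 p_pr; move: p_odd; case: (p) => [|[|[|]]] //= n _ _; lia.
Qed.

(** From [w^2 = P^2 + 1] follows [(w - P)(w + P) = 1]; both factors are constant, hence so is their
    difference [2 P], against [deg P >= 1]. *)
Lemma W_not_square (w : {poly 'F_p}) : w ^+ 2 != W.
Proof.
apply/eqP => E; have : (w - P) * (w + P) == 1.
  by rewrite -subr_sqr E /W addrAC subrr add0r.
move=> /eqP H; have sz (a b : {poly 'F_p}) : a * b = 1 -> (size a <= 1)%N.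
  move=> /(congr1 (fun r : {poly _} => size r)); rewrite size_poly1 => /eqP.
  by rewrite size_mul_eq1 => /andP[/eqP->].
have s1 := sz _ _ H; rewrite mulrC in H; have s2 := sz _ _ H.
have : (size (w + P - (w - P))%R <= 1)%N.
  by apply: leq_trans (size_polyD _ _) _; rewrite size_polyN geq_max s1 s2.
have -> : w + P - (w - P) = 2%:R *: P by rewrite scaler_nat; ring.
by rewrite size_scale ?two_neq0 // leqNgt P_size.
Qed.

(** From [v Phi = r] and [W Phi^2 = 1] follows [v^2 = W r^2]; then [r] divides [v] and [W] is the
    square of the quotient. *)
Lemma Phi_irrational : ~ lrational (val Phi).
Proof.
move=> [r [v [v0 E]]]; have {}E : lp v * Phi = lp r by apply: val_inj.
have Evr : v ^+ 2 = W * r ^+ 2.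
  apply: lp_inj; rewrite [RHS]rmorphM !rmorphXn /= -E exprMn.
  by rewrite mulrCA Phi_sqr mulr1.
have rv : r %| v by rewrite -(dvdp_pexp2r _ _ (isT : (0 < 2)%N)) Evr dvdp_mulIr.
have r0 : r ^+ 2 != 0.
  by apply: contra_neq v0 => r0; apply/eqP; rewrite -sqrf_eq0 Evr r0 mulr0.
move: rv Evr => /dvdpP[w ->]; rewrite exprMn => Ew.
by move/(mulIf r0)/eqP: Ew; rewrite (negPf (W_not_square w)).
Qed.

Lemma Phi_quad_irrational : quad_irrational (val Phi).
Proof.
split; first exact: lserP.
split; first exact: Phi_irrational.
exists W, 0, (- 1); split; first by left; apply: W_neq0.
have E : lp W * (Phi * Phi) + lp 0 * Phi + lp (- 1) = 0.
  by rewrite -expr2 Phi_sqr rmorph0 mul0r addr0 rmorphN rmorph1 subrr.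
exact: (congr1 val E).
Qed.

Variable M : nat.
Hypothesis M_gt0 : (0 < M)%N.
Let q := (p ^ M)%N.
(** [B] and [C] are the alternating partial quotients after [S M]; [eta] is the fractional part that
    goes with [B], and [delta M] the one that goes with [C]. *)
Let B : {poly 'F_p} := - (2%:R *: (W * S M)).
Let eta := - (lp W * delta M).
Let C : {poly 'F_p} := 2%:R *: S M.

Lemma q_gt2 : (2 < q)%N.
Proof.
have oM : odd q by rewrite oddX p_odd orbT.
by have : (M < q)%N by [apply: ltn_expl; apply: prime_gt1]; lia.
Qed.

Lemma lp_scale_nat n (r : {poly 'F_p}) : lp (n%:R *: r) = n%:R * lp r.
Proof. by rewrite scaler_nat rmorphMn mulr_natl. Qed.

Lemma quot1E : lp B + eta = - (lp W * (lp P ^+ q * Phi + lp (S M))).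
Proof. by rewrite /B /eta rmorphN /= lp_scale_nat rmorphM /delta -/q; ring. Qed.

Lemma quot2E : lp C + delta M = lp P ^+ q * Phi + lp (S M).
Proof. by rewrite /C lp_scale_nat /delta -/q; ring. Qed.

Lemma quot_mul : lp W * (delta M * (lp P ^+ q * Phi + lp (S M))) = - 1.
Proof.
transitivity ((lp P ^+ q) ^+ 2 * (lp W * Phi ^+ 2) - lp W * lp (S M) ^+ 2).
  by rewrite /delta -/q; ring.
by rewrite Phi_sqr S_sqr -/q; ring.
Qed.

Lemma quot1_inv : delta M * (lp B + eta) = 1.
Proof. by rewrite quot1E mulrN mulrCA quot_mul opprK. Qed.

Lemma quot2_inv : eta * (lp C + delta M) = 1.
Proof. by rewrite quot2E /eta mulNr -mulrA quot_mul opprK. Qed.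

Lemma size_B : size B = (d * q.+1).+1.
Proof.
rewrite /B size_polyN size_scale ?two_neq0 // size_mul ?W_neq0 //; last first.
  by rewrite -size_poly_gt0 size_S.
by rewrite size_W size_S -/q; have := q_gt2; nia.
Qed.

Lemma size_C : size C = (d * q.-1).+1.
Proof. by rewrite /C size_scale ?two_neq0 // size_S. Qed.

(** The crude bound gives [eta] degree at most [d], which is not yet negative but is below
    [deg B = d (q+1)]. So [lp B + eta] has exact degree [d (q+1)], and [delta M] is its inverse. *)
Lemma delta_deg : deg_le (- (d * q.+1)%N%:Z) (val (delta M)).
Proof.
have etad : deg_le d (val eta).
  apply: degN; apply: deg_leW (degM deg_le_lpW (delta_deg0 M)); lia.
have qd : d%:Z < (d * q.+1)%N by have := d_gt0; have := q_gt2; nia.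
apply: (deg_le_inv (x := lp B + eta)); last by rewrite mulrC quot1_inv.
  apply: degD; last by apply: deg_leW etad; apply: ltW.
  by apply: deg_lp; rewrite size_B.
rewrite -[val _ _]/(lpoly B (d * q.+1)%N + val eta (d * q.+1)%N) etad // addr0 /=.
have -> : (d * q.+1)%N = (size B).-1 by rewrite size_B.
by rewrite -[_`__]/(lead_coef B) lead_coef_eq0 -size_poly_gt0 size_B.
Qed.

Lemma delta_frac : deg_le (- 1) (val (delta M)).
Proof. by apply: deg_leW delta_deg; have := d_gt0; nia. Qed.

Lemma eta_frac : deg_le (- 1) (val eta).
Proof.
apply: degN; apply: deg_leW (degM deg_le_lpW delta_deg).
by have := d_gt0; have := q_gt2; nia.
Qed.

Lemma cf_step (F : fieldType) (z : laurent F) n (r : {poly F}) (g y : lser F) :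
  deg_le (- 1) (val g) -> g * y = 1 -> cf_quot z n = val (lp r + g) ->
  cf_quot z n.+1 = val y.
Proof. by move=> gN gy /= ->; rewrite fracpartE // (linvE gy). Qed.

Let x := lmul (val Phi) (lpoly (P ^+ q)).

Lemma P_q_PhiE : x = val (lp (S M) + delta M).
Proof.
have -> : lp (S M) + delta M = Phi * lp (P ^+ q).
  by rewrite [lp (P ^+ q)]rmorphXn addrC subrK mulrC.
by [].
Qed.

Lemma cf_quot_odd n :
  cf_quot x n.*2.+1 = val (lp B + eta) /\ cf_quot x n.*2.+2 = val (lp C + delta M).
Proof.
have H k : cf_quot x k = val (lp B + eta) -> cf_quot x k.+1 = val (lp C + delta M).
  exact: cf_step eta_frac quot2_inv.
elim: n => [|n [_ IH]].
  (* The initial quotient [S M + delta M] has the same fractional part as [C + delta M], so both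
     have the same successor. *)
  have E : cf_quot x 1 = val (lp B + eta) by apply: (@cf_step _ x 0) delta_frac quot1_inv P_q_PhiE.
  by split=> //; apply: H.
have E : cf_quot x n.*2.+3 = val (lp B + eta) by apply: cf_step delta_frac quot1_inv IH.
by rewrite doubleS; split=> //; apply: H.
Qed.

(** Minimality of [2] is not claimed: the existence of some period makes [period_length] positive,
    which is all the estimate of the ratio asks for. *)
Lemma cf_period_x : cf_period x 2.
Proof.
split=> //; exists 1%N.
exact: etrans (cf_quot_odd 1).1 (esym (cf_quot_odd 0).1).
Qed.

(** Bounding every partial quotient makes the values chosen by [period_start] and [period_length]
    irrelevant. *)
Lemma size_cf_pq n : (d * q.-1 < size (cf_pq x n))%N.
Proof.
rewrite /cf_pq; case: n => [|n].
  by rewrite /= P_q_PhiE polypartE ?size_S //; apply: delta_frac.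
have [E1 E2] := cf_quot_odd n./2.
have := odd_double_half n; case: (odd n) => <-; rewrite ?add1n ?add0n.
  by rewrite E2 polypartE ?size_C //; apply: delta_frac.
by rewrite E1 polypartE ?size_B; [nia|apply: eta_frac].
Qed.

End ContinuedFraction.

(** * Escape of mass *)

Section EscapeRatio.

Lemma period_length_gt0 (F : fieldType) (x : laurent F) l :
  cf_period x l -> (0 < period_length x)%N.
Proof.
move=> xl; rewrite /period_length; case: pselect => [H|[]].
  by case: cid => l' [[]].
have ex : exists l, `[< cf_period x l >] by exists l; apply/asboolP.
case: (ex_minnP ex) => m /asboolP xm mmin; exists m; split=> // l' xl'.
by apply: mmin; apply/asboolP.
Qed.

Lemma truncated_sum_ratio (R : realFieldType) (l D n : nat) (a : nat -> nat) :
  (0 < l)%N -> (0 < D)%N -> (forall i, (D <= a i)%N) ->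
  1 - n%:R / D%:R <=
    (\sum_(i < l) (a i - n)%N)%:R / (\sum_(i < l) a i)%:R :> R.
Proof.
move=> l0 D0 aD; set s' := (\sum_(i < l) _)%N; set s := (\sum_(i < l) a i)%N.
have ss' : (s <= s' + l * n)%N.
  rewrite -[l in (l * n)%N]card_ord -sum_nat_const -big_split /=.
  by apply: leq_sum => i _; lia.
have ls : (l * D <= s)%N.
  by rewrite -[l in (l * D)%N]card_ord -sum_nat_const; apply: leq_sum => i _.
have s0 : (0 < s)%N by nia.
(* Multiply [ss'] by [D] and bound [D * (l * n)] by [n * s] using [ls]. *)
have H : (D * s <= D * s' + n * s)%N by nia.
rewrite ler_pdivlMr ?ltr0n // mulrBl mul1r lerBlDr mulrAC -lerBlDl.
rewrite ler_pdivlMr ?ltr0n // mulrBl lerBlDl.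
by rewrite -!natrM -natrD ler_nat mulnC (mulnC s').
Qed.

Local Open Scope ereal_scope.

Lemma escape_ratio_le1 (F : fieldType) (T : laurent F) P k n :
  escape_ratio T P k n <= 1.
Proof.
rewrite /escape_ratio lee_fin; set s' := (\sum_(i < _) _)%N; set s := (\sum_(i < _) _)%N.
have ss : (s' <= s)%N by apply: leq_sum => i _; apply: leq_subr.
(* A zero denominator gives ratio [0], since [0^-1 = 0]. *)
have [->|s0] := eqVneq s 0%N; first by rewrite invr0 mulr0 ler01.
by rewrite ler_pdivrMr ?ltr0n ?lt0n // mul1r ler_nat.
Qed.

(** The second hypothesis brings values arbitrarily close to [c] into every tail, so all tail
    suprema equal [c]. *)
Lemma limn_esup_eq (R : realType) (u : (\bar R)^nat) (c : R) :
  (forall k, u k <= c%:E) ->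
  (forall (e : R) (K : nat), (0 < e)%R -> exists2 k, (K <= k)%N & c%:E <= u k + e%:E) ->
  limn_esup u = c%:E.
Proof.
move=> uc ue; rewrite limn_esup_lim (_ : esups u = cst c%:E) ?lim_cst //.
apply/funext => K; apply/eqP; rewrite eq_le; apply/andP; split.
  by apply: ub_ereal_sup => _ [k _ <-].
apply/lee_addgt0Pr => e e0; have [k Kk ck] := ue e K e0.
by apply: le_trans ck _; rewrite leeD2r //; apply: ereal_sup_ubound; exists k.
Qed.

End EscapeRatio.

Theorem theorem1p23 (p : nat) (P : {poly 'F_p}) :
  prime p -> odd p -> irreducible_poly P ->
  full_max_escape (lsubst (Theta_p p) P) P.
Proof.
move=> p_pr p_odd [P_size _].
have P0 : P != 0 by rewrite -size_poly_gt0; apply: ltnW.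
have [u Pu] := lp_inv P0.
split; first exact: (Phi_quad_irrational p_pr p_odd P_size Pu).
(* The upper limit over [k] is already [1] for each fixed [n], so the limit in [n] is that of a
   constant. *)
suff E n : limn_esup (fun k => escape_ratio (lsubst (Theta_p p) P) P k n) = 1%E.
  by under eq_fun do rewrite E; rewrite lim_cst.
apply: limn_esup_eq => [k|e K e0]; first exact: escape_ratio_le1.
(* [M >= K] puts the index [q = p^M] in the tail, and [M >= n / e] together with [D >= M] gives
   [n / D <= e]; the successor keeps [M] positive. *)
pose M := maxn K (Num.bound (n%:R / e)).+1; pose q := (p ^ M)%N.
have M0 : (0 < M)%N by rewrite leq_max orbT.
have KM : (K <= M)%N by apply: leq_maxl.
have Mq : (M < q)%N by apply: ltn_expl; apply: prime_gt1.
exists q; first exact: leq_trans KM (ltnW Mq).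
pose D := ((size P).-1 * q.-1)%N.
have MD : (M <= D)%N.
  have sP : (0 < (size P).-1)%N by rewrite -ltnS prednK // ltnW.
  by apply: leq_trans (leq_pmull _ sP); rewrite -ltnS (ltn_predK Mq).
have := truncated_sum_ratio.
pose x := lmul (lsubst (Theta_p p) P) (lpoly (P ^+ q)).
have l0 : (0 < period_length x)%N.
  exact: period_length_gt0 (cf_period_x p_pr p_odd P_size Pu M0).
have Da i : (D <= period_deg x i)%N.
  have := size_cf_pq p_pr p_odd P_size Pu M0 (period_start x + i).
  by rewrite /period_deg -/D; case: (size _).
have D0 : (0 < D)%N by apply: leq_trans MD.
move=> /(_ Rdefinitions.R _ D n (period_deg x) l0 D0 Da) H.
rewrite /escape_ratio -/x -EFinD lee_fin -lerBlDr; apply: le_trans H.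
rewrite lerD2l lerN2 ler_pdivrMr ?ltr0n // mulrC -ler_pdivrMr //.
have b0 : 0 <= n%:R / e by rewrite divr_ge0 ?ler0n // ltW.
apply: le_trans (ltW (archi_boundP b0)) _.
by rewrite ler_nat; apply: leq_trans MD; rewrite leq_max leqnSn orbT.
Qed.
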